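(* Let $(\prec)\in\mathrm{WO}(\mathrm{Tot})$. Then $(\prec)$ has a canonical join representation if and only if $(\prec)$ is widely generated. In this case, the canonical join representation of $(\prec)$ is $$(\prec)=\bigvee_{\mathfrak a\in\mathrm{LowerArcs}(\prec)}j_{\mathfrak a}.$$
   Context: $\mathrm{Tot}$ is the set of all (strict) total orders $\prec$ on $\mathbb{Z}$; $<$ denotes the usual order. $N(\prec)$ is the set of pairs $(a,b)$ with $a<b$ and $b\prec a$. $\mathrm{WO}(\mathrm{Tot})$ is $\mathrm{Tot}$ partially ordered by $(\prec_1)\le(\prec_2)$ iff $N(\prec_1)\subseteq N(\prec_2)$; it is a complete lattice. An arc is a tuple $\mathfrak a=(a,b,L,R)$ with $a<b$ integers and $L\sqcup R=\{a+1,\dots,b-1\}$. A pair $(a,b)$ with $a<b$ is a lower wall of $\prec$ if $b\prec a$ and there is no $c$ with $b\prec c\prec a$. An arc $(a,b,L,R)$ is a lower arc of $\prec$ if $(a,b)$ is a lower wall of $\prec$, $\ell\prec b$ for all $\ell\in L$, and $a\prec r$ for all $r\in R$. $\mathrm{LowerArcs}(\prec)$ is the set of lower arcs of $\prec$. For an arc $\mathfrak a=(a,b,L,R)$ with $L=\{\ell_1<\dots<\ell_j\}$, $R=\{r_1<\dots<r_k\}$, $j_{\mathfrak a}$ is the total order $\cdots\prec a-2\prec a-1\prec\ell_1\prec\cdots\prec\ell_j\prec b\prec a\prec r_1\prec\cdots\prec r_k\prec b+1\prec b+2\prec\cdots$. An element $x$ of a poset is widely generated if for all $y<x$ there is a cover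 relation $x'\lessdot x$ with $y\le x'$. In a complete lattice $\Lambda$, for $U,V\subseteq \Lambda$ write $U\ll V$ if every $u\in U$ satisfies $u\le v$ for some $v\in V$. A join representation $x=\bigvee U$ is irredundant if no proper subset $U'\subsetneq U$ has $\bigvee U'=x$. It is the canonical join representation of $x$ if it is irredundant and $U\ll V$ for every $V\subseteq \Lambda$ with $\bigvee V=x$. *)

(* Defs.v *)
From HB Require Import structures.
From mathcomp Require Import all_boot all_order all_algebra.
From mathcomp Require Import boolp classical_sets set_interval.

Set Implicit Arguments.
Unset Strict Implicit.
Unset Printing Implicit Defensive.

Import Order.TTheory GRing.Theory Num.Theory.

Local Open Scope order_scope.
Local Open Scope classical_set_scope.

(* Joins are expressed by [isLub U x]: [x] is the least upper bound of [U]. *)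
Section CanonicalJoin.
Context {d : Order.disp_t} {T : porderType d}.
Implicit Types (x y z : T) (U V : set T).

Definition covers x y := x < y /\ ~ exists z, x < z < y.

Definition widely_generated x :=
  forall y, y < x -> exists2 x', covers x' x & y <= x'.

Definition join_refines U V := forall u, U u -> exists2 v, V v & u <= v.

Definition irredundant_join x U :=
  isLub U x /\ forall U', U' `<` U -> ~ isLub U' x.

Definition canonical_join_representation x U :=
  irredundant_join x U /\ forall V, isLub V x -> join_refines U V.

End CanonicalJoin.

Record Tot := MkTot {
  tot_rel :> rel int;
  tot_irr : irreflexive tot_rel;
  tot_trans : transitive tot_rel;
  tot_total : forall a b, a != b -> tot_rel a b || tot_rel b a }.

Definition inversions (p : Tot) : set (int * int) :=
  [set ab | ab.1 < ab.2 /\ p ab.2 ab.1].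

Lemma tot_neg (p : Tot) (a b : int) : a != b -> p a b = ~~ p b a.
Proof.
move=> /(tot_total p); case pab: (p a b); case pba: (p b a) => //= _.
by have := tot_trans pab pba; rewrite tot_irr.
Qed.

HB.instance Definition _ := gen_eqMixin Tot.
HB.instance Definition _ := gen_choiceMixin Tot.

Definition weak_le : rel Tot :=
  fun p q => `[< inversions p `<=` inversions q >].

Fact weak_le_refl : reflexive weak_le.
Proof. by move=> p; apply/asboolP. Qed.

Fact weak_le_trans : transitive weak_le.
Proof.
by move=> q p r /asboolP pq /asboolP qr; apply/asboolP; apply: subset_trans qr.
Qed.

Fact weak_le_anti : antisymmetric weak_le.
Proof.
move=> p q /andP[/asboolP pq /asboolP qp].
have lt_eq a b : a < b -> p b a = q b a.
  move=> ab; apply/idP/idP => h.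
    by have [] := pq (a, b) (conj ab h).
  by have [] := qp (a, b) (conj ab h).
have pqE : tot_rel p = tot_rel q.
  apply/funext => a; apply/funext => b; case: (ltgtP a b) => [ab|ba|->].
  - by rewrite !(@tot_neg _ a b) ?lt_eqF // lt_eq.
  - exact: lt_eq.
  - by rewrite !tot_irr.
case: p q pqE {pq qp lt_eq} => [p p1 p2 p3] [q q1 q2 q3] /= pqE.
by subst q; congr MkTot; exact: Prop_irrelevance.
Qed.

Fact weak_display : Order.disp_t. Proof. exact: Order.Disp tt tt. Qed.

HB.instance Definition _ := Order.Le_isPOrder.Build weak_display Tot
  weak_le_refl weak_le_anti weak_le_trans.

Record Arc := MkArc {
  arc_a : int;
  arc_b : int;
  arc_L : set int;
  arc_R : set int;
  arc_lt : arc_a < arc_b;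
  arc_disj : arc_L `&` arc_R = set0;
  arc_cover : arc_L `|` arc_R = `]arc_a, arc_b[%classic }.

Definition lower_wall (p : Tot) (a b : int) :=
  [/\ a < b, p b a & ~ exists c, p b c && p c a].

Definition LowerArcs (p : Tot) : set Arc :=
  [set c | [/\ lower_wall p (arc_a c) (arc_b c),
               forall l, arc_L c l -> p l (arc_b c) &
               forall r, arc_R c r -> p (arc_a c) r]].

(* [arc_order c] is j_c: the consecutive blocks ]-oo, a[, L, {b}, {a}, R,
   ]b, +oo[ (numbered 0 to 5), each in its usual order. *)
Definition arc_block (c : Arc) (x : int) : nat :=
  if x < arc_a c then 0
  else if arc_b c < x then 5
  else if x == arc_b c then 2
  else if x == arc_a c then 3
  else if x \in arc_L c then 1 else 4.

Definition arc_order_rel (c : Arc) : rel int := fun x y =>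
  (arc_block c x < arc_block c y)%N ||
  (arc_block c x == arc_block c y) && (x < y).

Fact arc_order_irr c : irreflexive (arc_order_rel c).
Proof. by move=> x; rewrite /arc_order_rel ltnn ltxx andbF. Qed.

Fact arc_order_trans c : transitive (arc_order_rel c).
Proof.
move=> y x z /orP[xy|/andP[/eqP xy lxy]] /orP[yz|/andP[/eqP yz lyz]];
  rewrite /arc_order_rel.
- by rewrite (ltn_trans xy yz).
- by rewrite -yz xy.
- by rewrite xy yz.
- by rewrite xy yz eqxx (lt_trans lxy lyz) orbT.
Qed.

Fact arc_order_total c x y :
  x != y -> arc_order_rel c x y || arc_order_rel c y x.
Proof.
rewrite /arc_order_rel => xy.
case: (ltngtP (arc_block c x) (arc_block c y)) => //= _.
by rewrite -neq_lt.
Qed.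

Definition arc_order (c : Arc) : Tot :=
  MkTot (@arc_order_irr c) (@arc_order_trans c) (@arc_order_total c).

(* Main.v *)
(** If [p] is widely generated, let [y] be an upper bound of the [arc_order c],
    [c] a lower arc of [p]. Were the meet of [y] and [p] below [p], it would lie
    below some [q] covered by [p]; but [q] misses a lower wall [(a, b)] of [p],
    whereas [y] and [p] both lie above the arc order of that wall. That this
    join is canonical holds since [arc_order c] is the least element below [p]
    inverting its wall [(a, b)], while removing [(a, b)] from the
    inversions of [p] leaves an element of [Tot]; hence every [V] with join [p]
    has a member above [arc_order c], and no other lower arc can replace [c].

    If [U] is the canonical join representation of [x] and [u] is in [U], then
    the join of all [z <= x] with [u] not below [z] is again not above [u], and
    it is covered by [x]. For every [y < x] some [u] is not below [y], so [y]
    lies below that cover. *)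

Require Import Defs.
From mathcomp Require Import all_boot all_order all_algebra.
From mathcomp Require Import boolp classical_sets.
From mathcomp Require Import zify.
From Stdlib Require Import Relation_Operators.

Set Implicit Arguments.
Unset Strict Implicit.
Unset Printing Implicit Defensive.

Import Order.TTheory.

Local Open Scope order_scope.
Local Open Scope classical_set_scope.

(** * Canonical join representations in a poset *)

Section PosetJoins.
Context {d : Order.disp_t} {T : porderType d}.
Implicit Types (x y u : T) (U V : set T).

Lemma irredundant_join_antichain x U :
  irredundant_join x U -> forall u v, U u -> U v -> u <= v -> u = v.
Proof.
move=> [[Ux xU] irr] u v Uu Uv uv; apply/eqP/negP => /negP neq.
apply: (irr (U `\ u)).
  by split=> [w []//|/(_ u Uu)[_]]; apply.
split=> [w [Uw _]|y Uy]; first exact: Ux.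
apply: xU => w Uw; have [->|wu] := eqVneq w u.
  by apply: (le_trans uv); apply: Uy; split=> // vu; rewrite vu eqxx in neq.
by apply: Uy; split=> //; exact/eqP.
Qed.

(** Refinement in both directions gives [u <= v <= w] with [u] and [w] in the antichain [U], so all
    three coincide. Used both ways, this is uniqueness. *)
Lemma canonical_join_representation_sub x U V :
  canonical_join_representation x U -> canonical_join_representation x V ->
  U `<=` V.
Proof.
move=> [Uirr Uref] [Virr Vref] u Uu.
have [v Vv uv] := Uref V Virr.1 u Uu.
have [w Uw vw] := Vref U Uirr.1 v Vv.
have uw := irredundant_join_antichain Uirr Uu Uw (le_trans uv vw).
by rewrite (_ : u = v) //; apply/le_anti; rewrite uv uw vw.
Qed.

Hypothesis lub_ex : forall U, exists x, isLub U x.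

Lemma canonical_join_representation_widely_generated x U :
  canonical_join_representation x U -> widely_generated x.
Proof.
move=> [Uirr Uref] y yx; have [[Ux xU] _] := Uirr.
have [u Uu uy] : exists2 u, U u & ~ u <= y.
  apply/not_exists2P => Uy; move: yx.
  rewrite lt_leAnge => /andP[_ /negP]; apply.
  by apply: xU => u Uu; have [//|/contrapT] := Uy u.
pose K := [set z | z <= x /\ ~ u <= z].
have [m [Km mK]] := lub_ex K.
have mx : m <= x by apply: mK => z [].
(* If [u <= m], then [K] together with the rest of [U] would be a join
   representation of [x] that [U] does not refine. *)
have um : ~ u <= m.
  move=> um; have [] := Uref (K `|` U `\ u) _ u Uu.
    split=> [z [[]//|[Uz _]]|z Kz]; first exact: Ux.
    apply: xU => w Uw; have [->|wu] := eqVneq w u.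
      by apply: (le_trans um); apply: mK => v Kv; apply: Kz; left.
    by apply: Kz; right; split=> //; exact/eqP.
  move=> v [[_ //]|[Uv vu]] uv; apply: vu.
  by rewrite (irredundant_join_antichain Uirr Uu Uv uv).
exists m; last by apply: Km; split=> //; exact: ltW.
split.
  rewrite lt_neqAle mx andbT; apply/eqP => mE.
  by apply: um; rewrite mE; exact: Ux.
move=> [z /andP[mz zx]]; move: zx; rewrite lt_leAnge => /andP[zx /negP]; apply.
(* An element strictly above [m] and below [x] is not in [K], hence is above [u]. The other members
   of [U] are in [K], so it bounds them too and is above [x]. *)
have uz : u <= z.
  apply: contrapT => uz; have := Km z (conj zx uz).
  by move=> zm; have := lt_le_trans mz zm; rewrite ltxx.
apply: xU => w Uw; have [->//|/eqP wu] := eqVneq w u.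
apply: le_trans (ltW mz); apply: Km; split; first exact: Ux.
by move=> uw; apply: wu; rewrite (irredundant_join_antichain Uirr Uu Uw uw).
Qed.

End PosetJoins.

(** * Total orders with prescribed inversions; existence of joins *)

Section TotOfInversions.
Variable I : int -> int -> Prop.
Hypothesis I_lt : forall a b, I a b -> a < b.
Hypothesis I_trans : forall a b c, I a b -> I b c -> I a c.
Hypothesis I_cotrans : forall a b c, a < b -> b < c -> I a c -> I a b \/ I b c.

(** The hypotheses say that [I] and its complement among the pairs [a < b] are both transitive,
    which characterises inversion sets. *)
Definition inv_rel : rel int :=
  fun a b => `[< a < b /\ ~ I a b \/ I b a >].

Fact inv_rel_irr : irreflexive inv_rel.
Proof.
move=> a; apply/asboolP; rewrite ltxx => -[[//]|/I_lt].
by rewrite ltxx.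
Qed.

Fact inv_rel_trans : transitive inv_rel.
Proof.
move=> b a c /asboolP ab /asboolP bc; apply/asboolP.
case: ab => [[ab Iab]|Iba]; case: bc => [[bc Ibc]|Icb].
- by left; split=> [|/(I_cotrans ab bc)[]//]; exact: lt_trans bc.
- case: (ltgtP a c) => [ac|ca|ac].
  + by left; split=> // Iac; exact/Iab/(I_trans Iac Icb).
  + by right; have [//|/Iab] := I_cotrans ca ab Icb.
  + by subst c.
- case: (ltgtP a c) => [ac|ca|ac].
  + by left; split=> // Iac; exact/Ibc/(I_trans Iba Iac).
  + by right; have [/Ibc|//] := I_cotrans bc ca Iba.
  + by subst c.
- by right; exact: I_trans Iba.
Qed.

Fact inv_rel_total a b : a != b -> inv_rel a b || inv_rel b a.
Proof.
rewrite neq_lt => /orP[] ab; apply/orP.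
  by have [Iab|Iab] := pselect (I a b); [right|left]; apply/asboolP;
    [right|left].
by have [Iab|Iab] := pselect (I b a); [left|right]; apply/asboolP; [right|left].
Qed.

Definition tot_of_inv : Tot := MkTot inv_rel_irr inv_rel_trans inv_rel_total.

Lemma tot_of_invP a b : inversions tot_of_inv (a, b) <-> I a b.
Proof.
split=> [[/= ab /asboolP[[ba _]|//]]|Iab].
  by have := lt_trans ab ba; rewrite ltxx.
by split=> /=; [exact: I_lt|apply/asboolP; right].
Qed.

End TotOfInversions.

Lemma inversions_trans (p : Tot) a b c :
  inversions p (a, b) -> inversions p (b, c) -> inversions p (a, c).
Proof.
move=> [/= ab pba] [/= bc pcb]; split=> /=; first exact: lt_trans bc.
exact: tot_trans pba.
Qed.

Lemma inversions_cotrans (p : Tot) a b c : a < b -> b < c ->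
  inversions p (a, c) -> inversions p (a, b) \/ inversions p (b, c).
Proof.
move=> ab bc [/= _ pca]; have [pba|pba] := boolP (p b a); first by left.
by right; split=> //=; rewrite -tot_neg ?lt_eqF// in pba; exact: tot_trans pba.
Qed.

Lemma le_inversions (p q : Tot) : (p <= q) <-> inversions p `<=` inversions q.
Proof. by split=> /asboolP. Qed.

Definition inv_clos (V : set Tot) : int -> int -> Prop :=
  clos_trans int (fun a b => exists2 v, V v & inversions v (a, b)).

(** The join inverts the transitive closure of the union of the inversion sets. Cotransitivity
    survives the closure: if a chain from [a] to [c] passes through [e], a point between [a] and [c]
    is [e] or lies inside one of the two halves. *)
Lemma tot_lub_ex (V : set Tot) : exists p, isLub V p.
Proof.
have ltI a b : inv_clos V a b -> a < b.
  by elim=> {a b} [a b [v _ []]//|a b c _ ab _ bc]; exact: lt_trans bc.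
have transI a b c : inv_clos V a b -> inv_clos V b c -> inv_clos V a c.
  exact: t_trans.
have cotransI a b c : a < b -> b < c -> inv_clos V a c ->
    inv_clos V a b \/ inv_clos V b c.
  move=> ab bc ac; elim: ac b ab bc => {a c}
    [a c [v Vv ac]|a e c ae IH1 ec IH2] b ab bc.
    by case: (inversions_cotrans ab bc ac) => h; [left|right];
      apply: t_step; exists v.
  case: (ltgtP b e) => [be|eb|->]; last by left.
    by case: (IH1 b ab be) => h; [left|right; exact: transI ec].
  by case: (IH2 b eb bc) => h; [left; exact: transI h|right].
exists (tot_of_inv ltI transI cotransI); split=> [v Vv|w Vw];
  apply/le_inversions.
  by move=> [a b] vab; apply/tot_of_invP/t_step; exists v.
move=> [a b] /tot_of_invP; elim=> {a b} [a b [v Vv vab]|a b c _ ab _].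
  by move/le_inversions: (Vw v Vv); apply.
exact: inversions_trans.
Qed.

(** * Reordering convex sets; lower walls and covers *)

Section Splice.
Variables (p q : Tot) (I : pred int).
Hypothesis I_convex : forall x y z, I x -> I z -> p x y -> p y z -> I y.

Definition splice_rel : rel int :=
  fun x y => if I x && I y then q x y else p x y.

Fact splice_irr : irreflexive splice_rel.
Proof. by move=> x; rewrite /splice_rel !tot_irr if_same. Qed.

(** By convexity, a point outside [I] is on the same side of all of [I] in [p], so its comparisons
    do not depend on how [I] is reordered. *)
Fact splice_trans : transitive splice_rel.
Proof.
move=> y x z; rewrite /splice_rel.
have neq u v : I u -> ~~ I v -> u != v.
  by move=> Iu; apply: contraNneq => <-.
case: (boolP (I x)) => Ix; case: (boolP (I y)) => Iy;
  case: (boolP (I z)) => Iz //=; try exact: tot_trans.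
- move=> _ yz; rewrite tot_neg ?neq//; apply/negP => zx.
  by move/negP: Iz; apply; exact: I_convex yz zx.
- by move=> xy yz; move/negP: Iy; case; exact: I_convex xy yz.
- move=> xy _; rewrite tot_neg; last by rewrite eq_sym neq.
  apply/negP => zx; move/negP: Ix; apply; exact: I_convex zx xy.
Qed.

Fact splice_total x y : x != y -> splice_rel x y || splice_rel y x.
Proof.
rewrite /splice_rel [I y && _]andbC => xy.
by case: ifP => _; exact: tot_total.
Qed.

Definition splice : Tot := MkTot splice_irr splice_trans splice_total.

End Splice.
Arguments splice p q [I] I_convex.

Lemma lower_wall_exclusive {p : Tot} {a b c : int} :
  lower_wall p a b -> p b c -> ~~ p c a.
Proof.
by move=> [_ _ nc] bc; apply/negP => ca; apply: nc; exists c; rewrite bc.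
Qed.

Fact int_lt_total (a b : int) : a != b -> (a < b) || (b < a).
Proof. by rewrite neq_lt. Qed.

Definition tot_lt : Tot := MkTot ltxx lt_trans int_lt_total.

(** Since [b] and [a] are consecutive in [p], the pair they form is [p]-convex, and putting it back
    in the usual order alters no other comparison. *)
Lemma remove_lower_wall (p : Tot) (a b : int) : lower_wall p a b ->
  exists q : Tot, inversions q = inversions p `\ (a, b).
Proof.
move=> wab; have [ab pba nc] := wab.
pose I : pred int := fun x => (x == a) || (x == b).
have I_convex x y z : I x -> I z -> p x y -> p y z -> I y.
  move=> /orP[]/eqP-> /orP[]/eqP-> xy yz.
  - by have := tot_trans xy yz; rewrite tot_irr.
  - by have := tot_trans pba (tot_trans xy yz); rewrite tot_irr.
  - by case: nc; exists y; rewrite xy.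
  - by have := tot_trans xy yz; rewrite tot_irr.
exists (splice p tot_lt I_convex); apply/seteqP; split=> -[x y] /=.
  move=> [/= xy]; rewrite /splice_rel; case: ifP => [_ /= yx|nI pyx].
    by have := lt_trans xy yx; rewrite ltxx.
  by split=> // -[xa yb]; move: nI; rewrite /I xa yb !eqxx orbT.
move=> [[/= xy pyx] neq]; split=> //=; rewrite /splice_rel.
case: ifP => // /andP[] /orP[]/eqP yE /orP[]/eqP xE; subst x y => //;
  by rewrite ?ltxx // in xy; have := lt_trans xy ab; rewrite ltxx.
Qed.

(* If [b <_p a] is reversed in [q], replacing [p] by [q] on the p-interval
   [[b, a]] gives an element of [[q, p]] other than [p], hence [q]. So every
   inversion of [p] lost in [q] has both ends in [[b, a]], and by symmetry
   [(a, b)] is the only one. *)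
Lemma covers_lower_wall (p q : Tot) : covers q p ->
  exists2 ab, lower_wall p ab.1 ab.2 & ~ inversions q ab.
Proof.
move=> [qp ncov].
have qleN : inversions q `<=` inversions p by apply/le_inversions/ltW.
have lost x y : inversions p (x, y) -> ~ inversions q (x, y) ->
    forall x' y', inversions p (x', y') -> ~ inversions q (x', y') ->
    ((x' == x) || p x' x) && ((y == y') || p y y').
  move=> [/= xy pyx] nq x' y' [/= xy' pyx'] nq'.
  pose I : pred int := fun z => ((z == x) || p z x) && ((y == z) || p y z).
  have I_convex u v w : I u -> I w -> p u v -> p v w -> I v.
    move=> /andP[_ yu] /andP[wx _] uv vw; apply/andP; split; apply/orP; right.
      by case/orP: wx => [/eqP<-//|]; exact: tot_trans.
    by case/orP: yu => [/eqP->//|/tot_trans]; apply.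
  pose z := splice p q I_convex.
  have Ix : I x by rewrite /I eqxx pyx orbT.
  have Iy : I y by rewrite /I eqxx pyx orbT.
  have qz : q <= z.
    apply/le_inversions => -[u v] quv; have [_ /= pvu] := qleN _ quv.
    by case: quv => /= uv qvu; split=> //=; rewrite /splice_rel; case: ifP.
  have zp : z < p.
    rewrite lt_neqAle; apply/andP; split.
      apply/eqP => zE; apply: nq; split=> //=.
      by move: pyx; rewrite -zE /= /splice_rel Ix Iy.
    apply/le_inversions => -[u v] [/= uv]; rewrite /splice_rel.
    case: ifP => _ h; last by split.
    exact: (qleN (u, v)).
  have {zp qz} zq : q = z.
    apply/eqP/negP => /negP qz'; apply: ncov; exists z.
    by rewrite zp andbT lt_neqAle qz' qz.
  apply/negP => nI; apply: nq'; split=> //=.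
  rewrite zq /= /splice_rel; case: ifP => // /andP[Iy' Ix']; case: nI.
  by move: Ix' Iy' => /andP[-> _] /andP[_ ->].
have [[x y] [pxy nqxy]] : exists ab, inversions p ab /\ ~ inversions q ab.
  apply: contrapT => none; move: qp; rewrite lt_leAnge => /andP[_ /negP]; apply.
  apply/le_inversions => ab pab; apply: contrapT => nq.
  by apply: none; exists ab.
exists (x, y) => //; have [/= xy pyx] := pxy; split=> // -[c /andP[yc cx]].
have notboth u v : (u == v) || p u v -> (v == u) || p v u -> u = v.
  move=> /orP[/eqP//|uv] /orP[/eqP//|vu].
  by have := tot_trans uv vu; rewrite tot_irr.
have kept u v : p v u -> u != x \/ v != y -> q v u.
  move=> pvu neq; case: (ltgtP u v) => [uv|vu|uv].
  - have puv : inversions p (u, v) by [].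
    have [[]//|nquv] := pselect (inversions q (u, v)).
    have /andP[xu yv] := lost u v puv nquv x y pxy nqxy.
    have /andP[ux vy] := lost x y pxy nqxy u v puv nquv.
    have ux0 := notboth u x ux xu; have vy0 := notboth v y yv vy.
    by subst; case: neq; rewrite eqxx.
  - rewrite tot_neg ?lt_eqF//; apply/negP => quv.
    have [/= _ puv] := qleN (v, u) (conj vu quv).
    by have := tot_trans pvu puv; rewrite tot_irr.
  - by move: pvu; rewrite uv tot_irr.
(* Only [(x, y)] is lost in [q], so a [c] between [y] and [x] in [p] is still between them in [q],
   which forces [q y x]. *)
apply: nqxy; split=> //=; apply: (@tot_trans q c).
  by apply: kept => //; left; apply: contraTneq cx => ->; rewrite tot_irr.
by apply: kept => //; right; apply: contraTneq yc => ->; rewrite tot_irr.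
Qed.

(** * Arcs and their orders *)

Lemma int_itvP (a b x : int) :
  `]a, b[%classic x <-> a < x /\ x < b.
Proof. by rewrite /= in_itv /=; split=> [/andP|[-> ->]]. Qed.

Lemma arc_itv (c : Arc) x :
  arc_L c x \/ arc_R c x <-> arc_a c < x /\ x < arc_b c.
Proof. by rewrite -int_itvP -arc_cover. Qed.

Lemma arc_LR (c : Arc) x : arc_L c x -> ~ arc_R c x.
Proof.
by move=> Lx Rx; have : (arc_L c `&` arc_R c) x by []; rewrite arc_disj.
Qed.

(** [L] collects the points that [p] puts before [b]; the others come after [b], hence after [a], as
    nothing lies between [b] and [a]. *)
Lemma lower_arc_ex (p : Tot) a b : lower_wall p a b ->
  exists c, [/\ LowerArcs p c, arc_a c = a & arc_b c = b].
Proof.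
move=> wab; have [ab pba nc] := wab.
pose L := [set x | (a < x /\ x < b) /\ p x b].
pose R := [set x | (a < x /\ x < b) /\ ~~ p x b].
have LR0 : L `&` R = set0.
  by apply/seteqP; split=> x // [[_ h] [_ /negP]].
have LRab : L `|` R = `]a, b[%classic.
  apply/seteqP; split=> x; first by move=> [] [/int_itvP].
  by move=> /int_itvP xab; case: (boolP (p x b)) => h; [left|right].
exists (MkArc ab LR0 LRab); split=> //; split=> //= x [] // [ax xb].
rewrite -tot_neg ?gt_eqF// => bx; rewrite tot_neg ?lt_eqF//.
exact: lower_wall_exclusive bx.
Qed.

Variant arc_block_spec (c : Arc) (x : int) : nat -> Prop :=
  | ArcBlock0 of x < arc_a c : arc_block_spec c x 0
  | ArcBlock1 of arc_L c x : arc_block_spec c x 1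
  | ArcBlock2 of x = arc_b c : arc_block_spec c x 2
  | ArcBlock3 of x = arc_a c : arc_block_spec c x 3
  | ArcBlock4 of arc_R c x : arc_block_spec c x 4
  | ArcBlock5 of arc_b c < x : arc_block_spec c x 5.

Lemma arc_blockP (c : Arc) (x : int) : arc_block_spec c x (arc_block c x).
Proof.
rewrite /arc_block; case: ltgtP => [xa|ax|->]; first by constructor.
  case: ltgtP => [bx|xb|bx]; [by constructor| |by constructor].
  case: ifPn => [/set_mem|/negP]; first by constructor.
  (* Block 4 is a default value in [arc_block]; it is [R] because [L] and [R] cover the open
     interval. *)
  move=> nL; have [Lx|] := (arc_itv c x).2 (conj ax xb); last by constructor.
  by case: nL; apply/mem_set.
rewrite ltNge (ltW (arc_lt c)) /= lt_eqF ?arc_lt//; exact: ArcBlock3.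
Qed.

(** The outer blocks 0 and 5 are placed as usual, as are [L] before [b] and [a] before [R]. So an
    inversion has its larger entry in block 1 or 2 and its smaller one in block 3 or 4. *)
Lemma arc_inversionsP (c : Arc) x y : inversions (arc_order c) (x, y) <->
  x < y /\ (x = arc_a c \/ arc_R c x) /\ (y = arc_b c \/ arc_L c y).
Proof.
have ab := arc_lt c.
have Litv z : arc_L c z -> [/\ arc_a c < z, z < arc_b c & ~ arc_R c z].
  move=> Lz; have [az zb] := (arc_itv c z).1 (or_introl Lz).
  by split=> //; exact: arc_LR.
have Ritv z : arc_R c z -> [/\ arc_a c < z, z < arc_b c & ~ arc_L c z].
  move=> Rz; have [az zb] := (arc_itv c z).1 (or_intror Rz).
  by split=> // /arc_LR.
have nyx : x < y -> (y < x) = false.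
  by move=> xy; apply/negbTE; rewrite -leNgt ltW.
rewrite /inversions /= /arc_order_rel; split.
  move=> [xy]; rewrite nyx// andbF orbF => blk; split=> //; move: blk.
  case: (arc_blockP c x) => hx; case: (arc_blockP c y) => hy // _;
  try (have [? ? ?] := Litv _ hx); try (have [? ? ?] := Ritv _ hx);
  try (have [? ? ?] := Litv _ hy); try (have [? ? ?] := Ritv _ hy);
  try (exfalso; lia); split; tauto.
move=> [xy [hx hy]]; split=> //; apply/orP; left.
have {hx} : (2 < arc_block c x < 5)%N.
  case: (arc_blockP c x) => // h; exfalso; case: hx => hx;
  try (have [? ? ?] := Litv _ h); try (have [? ? ?] := Ritv _ hx);
  subst; try lia; done.
have {hy} : (0 < arc_block c y < 3)%N.
  case: (arc_blockP c y) => // h; exfalso; case: hy => hy;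
  try (have [? ? ?] := Ritv _ h); try (have [? ? ?] := Litv _ hy);
  subst; try lia; done.
lia.
Qed.

(** A pair not inverted by [p] is not inverted by [q] either, so [q] keeps [L] before [b] and [R]
    after [a]. For an inversion [(x, y)] of the arc order, [q] then lists [y], [b], [a], [x] in this
    order, up to equalities. *)
Lemma arc_order_le (p q : Tot) c : LowerArcs p c -> q <= p ->
  inversions q (arc_a c, arc_b c) -> arc_order c <= q.
Proof.
move=> [wab pL pR] /le_inversions qp [/= ab qba].
apply/le_inversions => -[x y] /arc_inversionsP[xy [hx hy]]; split=> //=.
have ax : x = arc_a c \/ q (arc_a c) x.
  case: hx => [->|Rx]; [by left|right].
  have [ax _] := (arc_itv c x).1 (or_intror Rx).
  rewrite tot_neg ?lt_eqF//; apply/negP => qxa.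
  have [_ /= pxa] := qp (_, _) (conj ax qxa).
  by have := tot_trans pxa (pR _ Rx); rewrite tot_irr.
have yb : y = arc_b c \/ q y (arc_b c).
  case: hy => [->|Ly]; [by left|right].
  have [_ yb] := (arc_itv c y).1 (or_introl Ly).
  rewrite tot_neg ?lt_eqF//; apply/negP => qby.
  have [_ /= pby] := qp (_, _) (conj yb qby).
  by have := tot_trans pby (pL _ Ly); rewrite tot_irr.
have qya : q y (arc_a c) by case: yb => [->//|yb]; exact: tot_trans yb qba.
by case: ax => [->//|]; exact: tot_trans qya.
Qed.

Lemma arc_order_inv (c : Arc) : inversions (arc_order c) (arc_a c, arc_b c).
Proof. by apply/arc_inversionsP; split; [exact: arc_lt|split; left]. Qed.

Lemma lower_arc_le (p : Tot) c : LowerArcs p c -> arc_order c <= p.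
Proof. by move=> pc; apply: (arc_order_le pc) => //; case: pc => [[]]. Qed.

(** In [p], the ends of the wall of [c'] lie weakly between those of the wall of [c], which are
    consecutive; so the walls agree, and each arc order is least for that wall. *)
Lemma lower_arc_wall_eq (p : Tot) c c' : LowerArcs p c -> LowerArcs p c' ->
  inversions (arc_order c') (arc_a c, arc_b c) -> arc_order c = arc_order c'.
Proof.
move=> pc pc' /arc_inversionsP[ab [ha hb]].
have [wab _ _] := pc; have [[_ pba _] pL pR] := pc'.
have bb' : arc_b c = arc_b c' \/ p (arc_b c) (arc_b c').
  by case: hb => [|/pL]; [left|right].
have aa' : arc_a c = arc_a c' \/ p (arc_a c') (arc_a c).
  by case: ha => [|/pR]; [left|right].
have {}aa' : arc_a c = arc_a c'.
  case: aa' => // a'a; have/negP[//] : ~~ p (arc_a c') (arc_a c).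
  by apply: (lower_wall_exclusive wab); case: bb' => [->//|/tot_trans]; apply.
have {}bb' : arc_b c = arc_b c'.
  case: bb' => // bb'; have/negP[] := lower_wall_exclusive wab bb'.
  by rewrite aa'.
apply/le_anti/andP; split.
  apply: (arc_order_le pc); first exact: lower_arc_le.
  by rewrite aa' bb'; exact: arc_order_inv.
apply: (arc_order_le pc'); first exact: lower_arc_le.
by rewrite -aa' -bb'; exact: arc_order_inv.
Qed.

(** * Canonical joins of arc orders *)

Lemma join_lower_wall (p : Tot) V a b : isLub V p -> lower_wall p a b ->
  exists2 v, V v & inversions v (a, b).
Proof.
move=> [Vp pV] wab; apply/not_exists2P => nV.
have [q qE] := remove_lower_wall wab.
have /le_inversions pq : p <= q.
  apply: pV => v Vv; apply/le_inversions => ab vab.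
  have /le_inversions/(_ _ vab) := Vp v Vv.
  rewrite qE => pab; split=> // abE; have [//|] := nV v.
  by rewrite -abE.
have [ab pba _] := wab; have := pq (a, b) (conj ab pba).
by rewrite qE => -[_]; apply.
Qed.

Lemma lower_arcs_canonical (p : Tot) : isLub (arc_order @` LowerArcs p) p ->
  canonical_join_representation p (arc_order @` LowerArcs p).
Proof.
move=> Jp; split; last first.
  move=> V Vp _ [c pc <-]; have [wab _ _] := pc.
  have [v Vv vab] := join_lower_wall Vp wab.
  by exists v => //; apply: (arc_order_le pc _ vab); case: Vp => + _; exact.
split=> // U' [U'J nJU'] U'p; apply: nJU' => _ [c pc <-].
have [wab _ _] := pc.
(* Some member of [U'] inverts the wall of [c]; being itself the order of a lower arc, it equals
   [arc_order c]. *)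
have [u U'u] := join_lower_wall U'p wab.
have [c' pc' uE] := U'J u U'u; rewrite -uE in U'u *.
by move=> /(lower_arc_wall_eq pc pc')->.
Qed.

Lemma widely_generated_lower_arcs (p : Tot) : widely_generated p ->
  isLub (arc_order @` LowerArcs p) p.
Proof.
move=> wp; split=> [_ [c pc <-]|y Jy]; first exact: lower_arc_le.
(* The meet of [p] and [y], obtained as the join of their common lower bounds. *)
have [m [Km mK]] := tot_lub_ex [set z | z <= p /\ z <= y].
have mp : m <= p by apply: mK => z [].
have my : m <= y by apply: mK => z [].
have [<-//|mneqp] := eqVneq m p.
have [|q qp mq] := wp m; first by rewrite lt_neqAle mneqp.
have [[a b] /= wab] := covers_lower_wall qp.
have [c [pc aE bE]] := lower_arc_ex wab.
have cm : arc_order c <= m.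
  by apply: Km; split; [exact: lower_arc_le|apply: Jy; exists c].
have /le_inversions cq := le_trans cm mq.
by case; apply: cq; rewrite -aE -bE; exact: arc_order_inv.
Qed.

Theorem theorem3p22 (p : Tot) :
  ((exists U : set Tot, canonical_join_representation p U) <->
   widely_generated p) /\
  (widely_generated p ->
   forall U : set Tot,
     canonical_join_representation p U <-> U = arc_order @` LowerArcs p).
Proof.
have canJ : widely_generated p ->
    canonical_join_representation p (arc_order @` LowerArcs p).
  by move=> /widely_generated_lower_arcs/lower_arcs_canonical.
split; first split.
- move=> [U pU].
  exact: (canonical_join_representation_widely_generated tot_lub_ex pU).
- by move=> /canJ pJ; exists (arc_order @` LowerArcs p).
move=> /canJ pJ U; split=> [pU|->//]; apply/seteqP; split.
  exact: (canonical_join_representation_sub pU pJ).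
exact: (canonical_join_representation_sub pJ pU).
Qed.
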